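(* Let $x,y,v$ be indeterminates and let the polynomials $B_n(x,y,v)$ ($n\ge0$) be defined by the S-type continued fraction $$\sum_{n=0}^\infty B_n(x,y,v)\,t^n=\cfrac{1}{1-\cfrac{\alpha_1t}{1-\cfrac{\alpha_2t}{1-\cfrac{\alpha_3t}{1-\cdots}}}}$$ with coefficients $\alpha_{2k-1}=x$ and $\alpha_{2k}=y+(k-1)v$ for $k\ge1$. Then for all $n\ge0$ $$B_n(x,y,v)=\sum_{\pi\in\Pi_n}x^{|\pi|}\,y^{\mathrm{erec}(\pi)}\,v^{\,n-|\pi|-\mathrm{erec}(\pi)},$$ where $|\pi|$ [resp. $\mathrm{erec}(\pi)$] denotes the number of blocks (resp. exclusive records) in $\pi$.
   Context: $\Pi_n$ is the set of partitions of $[n]=\{1,\dots,n\}$ into nonempty blocks. Continued fractions are identities of formal power series in $t$. Given $\pi\in\Pi_n$ and $i\in[n]$, let $\sigma'(i)$ be the next-larger element after $i$ in the block of $\pi$ containing $i$, if $i$ is not the largest element of its block, and $\sigma'(i)=0$ otherwise. An index $i\in[n]$ is an exclusive record of $\pi$ if $\sigma'(i)\ne0$ and $\sigma'(j)<\sigma'(i)$ for all $j<i$. (The exponent $n-|\pi|-\mathrm{erec}(\pi)$ is nonnegative.) *)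

(* Defs.v *)
From HB Require Import structures.
From mathcomp Require Import all_boot all_order all_algebra.
From mathcomp Require Export mpoly.

Set Implicit Arguments.
Unset Strict Implicit.
Unset Printing Implicit Defensive.

Import GRing.Theory.

Local Open Scope ring_scope.

(* A formal power series in t is its sequence of coefficients. *)
Definition fps (R : comNzRingType) := nat -> R.

Section FormalPowerSeries.

Variable R : comNzRingType.

Definition fps1 : fps R := fun n => (n == 0%N)%:R.

Definition fps_mul (f g : fps R) : fps R :=
  fun n => \sum_(i < n.+1) f i * g (n - i)%N.

Definition fps_exp (f : fps R) (j : nat) : fps R := iter j (fps_mul f) fps1.

(* a * t * f *)
Definition fps_scale_shift (a : R) (f : fps R) : fps R :=
  fun n => if n is m.+1 then a * f m else 0.

(* 1 / (1 - u) = \sum_j u ^ j, for u with zero constant term: u ^ j then has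
   no coefficients below t ^ j; see fps_geomK. *)
Definition fps_geom (u : fps R) : fps R :=
  fun n => \sum_(j < n.+1) fps_exp u j n.

(* The S-fraction 1 / (1 - alpha_k t / (1 - alpha_{k+1} t / ...)), cut after
   m levels. *)
Fixpoint Sconvergent (alpha : nat -> R) (m k : nat) : fps R :=
  if m is m'.+1 then
    fps_geom (fps_scale_shift (alpha k) (Sconvergent alpha m' k.+1))
  else fps1.

(* f is the infinite S-fraction with coefficients alpha_1, alpha_2, ... (alpha 0
   is unused): the t-adic limit of its convergents. *)
Definition is_Sfraction (alpha : nat -> R) (f : fps R) : Prop :=
  forall n, exists M, forall m, (M <= m)%N -> Sconvergent alpha m 1 n = f n.

Lemma fps_exp_small (u : fps R) j n :
  u 0%N = 0 -> (n < j)%N -> fps_exp u j n = 0.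
Proof.
move=> u0; elim: j n => // j IH n lt_nj.
rewrite /fps_exp iterS -/(fps_exp u j) /fps_mul big1 // => -[[|i] /= lt_in] _.
  by rewrite u0 mul0r.
by rewrite IH ?mulr0 // subnS; case: n lt_nj lt_in => // n; rewrite !ltnS =>
  lt_nj lt_in; rewrite subSn ?leq_subr //=; apply: leq_ltn_trans (leq_subr _ _) _.
Qed.

Lemma fps_geomK (u : fps R) : u 0%N = 0 ->
  forall n, fps_mul (fun i => fps1 i - u i) (fps_geom u) n = fps1 n.
Proof.
move=> u0 n; rewrite /fps_mul.
under eq_bigr do rewrite mulrBl.
rewrite sumrB big_ord_recl /= subn0 mul1r big1 ?addr0; last first.
  by move=> i _; rewrite /fps1 /= mul0r.
have -> : \sum_(i < n.+1) u i * fps_geom u (n - i)%N =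
          \sum_(j < n.+1) fps_exp u j.+1 n.
  rewrite [RHS]exchange_big /=; apply: eq_bigr => i _; rewrite -mulr_sumr.
  congr (_ * _); rewrite /fps_geom -!(big_mkord xpredT (fun j => fps_exp u j _)).
  have le_in : ((n - i).+1 <= n.+1)%N by rewrite ltnS leq_subr.
  rewrite [RHS](big_cat_nat (n := (n - i).+1)) //= [X in _ = _ + X]big_nat_cond.
  by rewrite [X in _ = _ + X]big1 ?addr0 // => j /andP[/andP[/fps_exp_small-> ]].
have top0 : fps_mul u (fps_exp u n) n = 0.
  rewrite -[LHS]/(fps_exp u n.+1 n). exact: fps_exp_small.
by rewrite /fps_geom big_ord_recl [X in _ - X]big_ord_recr /= top0 addr0 addrK.
Qed.

Lemma fps_geom_eq (u w : fps R) n :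
  (forall i, (i <= n)%N -> u i = w i) -> fps_geom u n = fps_geom w n.
Proof.
move=> uw; apply: eq_bigr => -[j /= _] _.
elim: j n uw => // j IH n uw.
rewrite /fps_exp !iterS; apply: eq_bigr => -[i /= lt_in] _.
rewrite uw //; congr (_ * _); apply: IH => l le_l.
by apply: uw; apply: leq_trans le_l (leq_subr _ _).
Qed.

Lemma Sconvergent_stable (alpha : nat -> R) m1 m2 k n :
  (n <= m1)%N -> (n <= m2)%N ->
  Sconvergent alpha m1 k n = Sconvergent alpha m2 k n.
Proof.
have geom0 u : fps_geom u 0 = 1 by rewrite /fps_geom big_ord1.
elim: m1 m2 k n => [|m1 IH] [|m2] k n; rewrite ?leqn0 //=.
- by move=> /eqP -> _; rewrite geom0.
- by move=> _ /eqP ->; rewrite geom0.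
move=> le1 le2; apply: fps_geom_eq => -[|i] //= le_in.
by congr (_ * _); apply: IH; rewrite -ltnS; apply: leq_trans le_in _.
Qed.

Lemma is_Sfraction_exists (alpha : nat -> R) : exists f, is_Sfraction alpha f.
Proof.
exists (fun n => Sconvergent alpha n 1 n) => n; exists n => m le_nm.
exact: Sconvergent_stable.
Qed.

Lemma is_Sfraction_unique (alpha : nat -> R) f g :
  is_Sfraction alpha f -> is_Sfraction alpha g -> f =1 g.
Proof.
move=> hf hg n; have [M1 h1] := hf n; have [M2 h2] := hg n.
by rewrite -(h1 (maxn M1 M2)) ?leq_maxl // h2 ?leq_maxr.
Qed.

End FormalPowerSeries.

(* The element i of [n] = {1, ..., n} is represented by the ordinal of value
   i - 1 in 'I_n.  The definitions below are meant for P a partition of the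
   full set [set: 'I_n]. *)

(* sigma'(i) as an element of {0} \cup [n], hence the shift j.+1; 0 means that i
   is the largest element of its block. *)
Definition next_in_block (n : nat) (P : {set {set 'I_n}}) (i : 'I_n) : nat :=
  if [pick j in pblock P i | (i < j)%N
        & [forall k in pblock P i, (i < k)%N ==> (j <= k)%N]] is Some j
  then j.+1 else 0%N.

Definition exclusive_record (n : nat) (P : {set {set 'I_n}}) (i : 'I_n) : bool :=
  (next_in_block P i != 0%N) &&
  [forall j : 'I_n, (j < i)%N ==> (next_in_block P j < next_in_block P i)%N].

Definition erec (n : nat) (P : {set {set 'I_n}}) : nat :=
  #|[set i | exclusive_record P i]|.

(* Main.v *)
Require Import Defs.
From mathcomp Require Import all_boot all_order all_algebra.
From mathcomp Require Import mpoly.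

(** Both sides are sums over the same kind of lattice path, computed level by
level.

An S-fraction counts Dyck paths in which a fall from level [l] to [l - 1]
weighs [alpha_l].  If [g_k] is the tail of the fraction that starts at
[alpha_k], then [g_k = 1 + alpha_k t g_k g_(k+1)], so the products
[p_l = g_1 ... g_(l+1)] satisfy [p_l = p_(l-1) + alpha_(l+1) t p_(l+1)], which,
up to the factor [alpha_1 ... alpha_l], is the recursion of the weighted paths
that end at level [l] (lemmas [dyck_Stail_prod] and [Sfraction_dyck]).

A partition is the same thing as a set of arcs [(i, sigma' i)] going to the
right, no two with the same source or the same target: the blocks are the
maximal chains of arcs, and their number is the number of indices that are not
a source.  Choose the arcs from the largest source to the smallest, while
keeping the set [A] of targets that lie to the right, still have no source, and
must get one later.  When the source [i] is treated,
- it may be the largest element of its block: weight [x];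
- or it takes its target in [A].  All other elements of [A] will be targets of
  smaller sources, so [i] is an exclusive record exactly when it takes the
  largest element of [A]: weight [y] for one choice, [v] for the #|A| - 1
  others.
Then [i] itself may or may not be declared a future target.  The weight of
the continuation depends on #|A| only, and these two half steps are
the two kinds of steps of a Dyck path at even and odd levels, with
[alpha_(2a+1) = x] and [alpha_(2a) = y + (a - 1) v].  This is [rows_sum_dyck];
the dictionary between partitions and sets of arcs is [chain_next_map],
[next_map_chain] and [partition_weight]. *)

Set Implicit Arguments.
Unset Strict Implicit.
Unset Printing Implicit Defensive.

Import GRing.Theory.
Local Open Scope ring_scope.

(** * S-fractions and weighted Dyck paths *)

Section DyckPaths.

Variables (R : comNzRingType) (alpha : nat -> R).

(** Coefficients of truncated polynomials compute Cauchy products, which gives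
    the ring laws for series from those of polynomials. *)
Lemma fps_mul_poly N (f g : fps R) n : (n < N)%N ->
  fps_mul f g n = (\poly_(i < N) f i * \poly_(i < N) g i)`_n.
Proof.
move=> lt_nN; rewrite coefM; apply: eq_bigr => -[i /= le_in] _.
by rewrite !coef_poly (leq_trans le_in lt_nN) (leq_ltn_trans (leq_subr _ _) lt_nN).
Qed.

Lemma fps_mulA (f g h : fps R) n :
  fps_mul f (fps_mul g h) n = fps_mul (fps_mul f g) h n.
Proof.
pose T (u : fps R) := \poly_(i < n.+1) u i.
have TM u w i : (i < n.+1)%N -> (T (fps_mul u w))`_i = (T u * T w)`_i.
  by move=> lt_in; rewrite coef_poly lt_in (fps_mul_poly _ _ lt_in).
rewrite !(@fps_mul_poly n.+1) // -!/(T _).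
transitivity (T f * (T g * T h))`_n; last rewrite mulrA.
  rewrite !coefM; apply: eq_bigr => i _; congr (_ * _).
  by apply: TM; rewrite ltnS leq_subr.
by rewrite !coefM; apply: eq_bigr => i _; congr (_ * _); rewrite TM.
Qed.

Lemma fps_geom_fix (u : fps R) n : u 0%N = 0 ->
  fps_geom u n = fps1 R n + fps_mul u (fps_geom u) n.
Proof.
move=> u0; rewrite -(fps_geomK u0) /fps_mul.
under eq_bigr do rewrite mulrBl.
rewrite sumrB subrK big_ord_recl /= subn0 mul1r big1 ?addr0 // => i _.
by rewrite /fps1 mul0r.
Qed.

(** The infinite S-fraction with coefficients [alpha k, alpha k.+1, ...]: its
    [n]-th coefficient no longer changes after [n] levels. *)
Definition Stail (k : nat) : fps R := fun n => Sconvergent alpha n k n.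

Lemma Stail_geom k n :
  Stail k n = fps_geom (fps_scale_shift (alpha k) (Stail k.+1)) n.
Proof.
rewrite /Stail (@Sconvergent_stable _ alpha n n.+1) ?leqnSn //=.
apply: fps_geom_eq => -[|i] //= le_in.
by congr (_ * _); apply: Sconvergent_stable => //; apply: ltnW.
Qed.

Lemma StailE k n : Stail k n =
  if n is m.+1 then alpha k * fps_mul (Stail k.+1) (Stail k) m else 1.
Proof.
rewrite Stail_geom; case: n => [|n]; first by rewrite /fps_geom big_ord1.
rewrite fps_geom_fix // /fps1 add0r /fps_mul big_ord_recl mul0r add0r mulr_sumr.
by apply: eq_bigr => i _; rewrite -Stail_geom mulrA.
Qed.

(** The product of the tails that start at [1, ..., l.+1].  Cutting a Dyck path
    from level [0] to level [l] at its last visit to each level shows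
    that, up to the weight of the [l] rises, this product is its generating
    function. *)
Fixpoint Stail_prod (l : nat) : fps R :=
  if l is l'.+1 then fps_mul (Stail l.+1) (Stail_prod l') else Stail 1.

Lemma Stail_prod0 l : Stail_prod l 0%N = 1.
Proof.
elim: l => [|l IH] /=; first by rewrite StailE.
by rewrite /fps_mul big_ord1 subnn IH StailE mulr1.
Qed.

Lemma Stail_prod0S n : Stail_prod 0 n.+1 = alpha 1 * Stail_prod 1 n.
Proof. exact: StailE. Qed.

Lemma Stail_prodSS l n : Stail_prod l.+1 n.+1 =
  Stail_prod l n.+1 + alpha l.+2 * Stail_prod l.+2 n.
Proof.
rewrite [LHS]/= /fps_mul big_ord_recl StailE mul1r subn0; congr (_ + _).
rewrite [Stail_prod l.+2 n]fps_mulA mulr_sumr.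
by apply: eq_bigr => i _; rewrite StailE mulrA.
Qed.

(** Weighted paths of length [m] from level [0] to level [l], read from the
    end: the weight [alpha l] is here carried by the rises to level [l], which
    gives the same sum over closed paths as weights on the falls. *)
Fixpoint dyck (m l : nat) : R :=
  if m is m'.+1 then
    dyck m' l.+1 + (if l is l'.+1 then alpha l * dyck m' l' else 0)
  else (l == 0)%:R.

Lemma dyck_gt m l : (m < l)%N -> dyck m l = 0.
Proof.
elim: m l => [|m IH] [|l] //= lt_ml.
by rewrite !IH ?mulr0 ?addr0 // ltnW // ltnW.
Qed.

Lemma dyck_Stail_prod l n :
  dyck (l + n.*2) l = (\prod_(i < l) alpha i.+1) * Stail_prod l n.
Proof.
move: {2}(l + n.*2)%N (erefl (l + n.*2)%N) => m.
elim: m l n => [|m IH] l n => [/eqP|Dm].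
  rewrite addn_eq0 double_eq0 => /andP[/eqP-> /eqP->].
  by rewrite big_ord0 mul1r Stail_prod0.
rewrite Dm /=; case: n Dm => [|n] Dm.
  rewrite addn0 in Dm; rewrite dyck_gt -?Dm // add0r Dm Stail_prod0 mulr1.
  have := IH m 0%N (addn0 m); rewrite double0 addn0 Stail_prod0 mulr1 => ->.
  by rewrite big_ord_recr mulrC.
have Dm1: (l.+1 + n.*2)%N = m by move: Dm; rewrite doubleS !addnS => -[].
rewrite -{1}Dm1 IH // big_ord_recr /=.
case: l Dm Dm1 => [|l] Dm Dm1.
  by rewrite big_ord0 addr0 !mul1r Stail_prod0S.
have Dm2: (l + n.+1.*2)%N = m by case: Dm.
rewrite -Dm2 IH // Stail_prodSS mulrDr [RHS]addrC [in RHS]mulrA.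
congr (_ + _); rewrite mulrA; congr (_ * _).
by rewrite big_ord_recr mulrC.
Qed.

Lemma Sfraction_dyck (f : fps R) n :
  is_Sfraction alpha f -> f n = dyck n.*2 0.
Proof.
case/(_ n) => M fE; rewrite -[n.*2]add0n dyck_Stail_prod big_ord0 mul1r.
rewrite -(fE (maxn M n)) ?leq_maxl //.
by apply: Sconvergent_stable; rewrite ?leq_maxr.
Qed.

End DyckPaths.

(** * Sums over sets of arcs, one source at a time *)

Section RowByRow.

Variables (n : nat) (R : comNzRingType) (x y v : R).

Implicit Types (f : {ffun 'I_n -> option 'I_n}) (A : {set 'I_n}).

(** The encoding of [sigma'] by a number in [{0, ..., n}], with [0] for no arc. *)
Definition succ_pos f (i : 'I_n) : nat := if f i is Some j then j.+1 else 0%N.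

Definition is_record f i :=
  (succ_pos f i != 0%N) &&
  [forall j : 'I_n, (j < i)%N ==> (succ_pos f j < succ_pos f i)%N].

Definition row_weight f i : R :=
  if f i is Some _ then if is_record f i then y else v else x.

(** The arcs that can leave the sources below [s] when [A] is the set of awaiting
    targets.  Only [t = s] and [t = s.+1] occur: in the
    second case it is still open whether [s] is itself a target. *)
Definition fits (s t : nat) A f :=
  [&& [forall i, forall j, (f i == Some j) ==>
         [&& (i < s)%N, (i < j)%N & (j < t)%N || (j \in A)]],
      [forall i, forall k, forall j,
         (f i == Some j) ==> (f k == Some j) ==> (i == k)]
    & [forall j in A, exists i, f i == Some j]].

Lemma fitsP s t A f :
  reflect [/\ forall i j, f i = Some j ->
                [/\ (i < s)%N, (i < j)%N & (j < t)%N || (j \in A)],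
              forall i k j, f i = Some j -> f k = Some j -> i = k
            & forall j, j \in A -> exists i, f i = Some j]
          (fits s t A f).
Proof.
apply: (iffP and3P) => -[arcs inj im]; split.
- move=> i j /eqP fi; apply/and3P.
  by move/forallP/(_ i)/forallP/(_ j)/implyP: arcs; apply.
- move=> i k j /eqP fi /eqP fk; apply/eqP.
  by move/forallP/(_ i)/forallP/(_ k)/forallP/(_ j): inj; rewrite fi fk.
- by move=> j /(forall_inP im) /existsP[i /eqP]; exists i.
- apply/forallP => i; apply/forallP => j; apply/implyP => /eqP /arcs ?.
  exact/and3P.
- apply/forallP => i; apply/forallP => k; apply/forallP => j.
  by apply/implyP => /eqP fi; apply/implyP => /eqP fk; apply/eqP/(inj _ _ j).
- by apply/forall_inP => j /im[i fi]; apply/existsP; exists i; apply/eqP.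
Qed.

Definition rows_sum s t A : R :=
  \sum_(f | fits s t A f) \prod_(i < n | (i < s)%N) row_weight f i.

Lemma rows_sum0 A : rows_sum 0 0 A = (#|A| == 0%N)%:R.
Proof.
have fits0 f : fits 0 0 A f = (A == set0) && (f == [ffun=> None]).
  apply/fitsP/andP => [[arcs _ im]|[/eqP-> /eqP->]].
    have f0 i : f i = None by case fi: (f i) => [j|] //; case/arcs: fi.
    split; last by apply/eqP/ffunP => i; rewrite ffunE f0.
    by apply/eqP/setP => j; rewrite inE; apply/negP => /im[i]; rewrite f0.
  by split=> [i j|i k j|j]; rewrite ?ffunE ?inE.
rewrite /rows_sum cards_eq0 (eq_bigl _ _ fits0).
case: eqP => _ /=; last by rewrite big_pred0.
by rewrite big_pred1_eq big_pred0.
Qed.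

(** The odd half step: decide whether the element [s] is a target. *)
Lemma rows_sum_column s A (c : 'I_n) : c = s :> nat -> c \notin A ->
  rows_sum s s.+1 A = rows_sum s s A + rows_sum s s (c |: A).
Proof.
move=> Dc cNA; rewrite /rows_sum addrC.
rewrite (bigID (fun f => [exists i, f i == Some c])) /=.
have lt_s (j : 'I_n) : (j < s.+1)%N || (j \in A) = (j < s)%N || (j \in c |: A).
  by rewrite ltnS leq_eqVlt !inE -val_eqE /= Dc; case: (j < s)%N; rewrite ?orbT ?orbF.
congr (_ + _); apply: eq_bigl => f.
  apply/andP/fitsP => [[/fitsP[arcs inj im] /existsP[i0 /eqP fi0]]|[arcs inj im]].
    split=> // [i j /arcs|j]; first by rewrite lt_s.
    by case/setU1P=> [->|/im //]; exists i0.
  split; last by case: (im c) => [|i /eqP fi]; [rewrite setU11|apply/existsP; exists i].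
  apply/fitsP; split=> // [i j /arcs|j jA]; first by rewrite lt_s.
  by apply: im; rewrite setU1r.
apply/andP/fitsP => [[/fitsP[arcs inj im] /existsPn Ncim]|[arcs inj im]].
  split=> // i j fi; have [? ? lt_j] := arcs i j fi; split=> //.
  move: lt_j; rewrite ltnS leq_eqVlt -Dc; case: eqP => //= /val_inj Dj.
  by have := Ncim i; rewrite fi Dj eqxx.
split.
  apply/fitsP; split=> // i j /arcs[? ? /orP[lt_j|jA]].
    by split=> //; rewrite ltnW.
  by rewrite jA orbT.
apply/existsPn => i; apply/eqP => /arcs[_ _].
by rewrite Dc ltnn (negPf cNA).
Qed.

Definition set_row (i0 : 'I_n) (o : option 'I_n) f : {ffun 'I_n -> option 'I_n} :=
  [ffun i => if i == i0 then o else f i].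

Lemma fits_none s t A f (i0 : 'I_n) :
  i0 = s :> nat -> fits s.+1 t A f && (f i0 == None) = fits s t A f.
Proof.
move=> Di0; apply/andP/fitsP => [[/fitsP[arcs inj im] /eqP fi0]|[arcs inj im]].
  split=> // i j fi; have [lt_i lt_ij jt] := arcs i j fi; split=> //.
  move: lt_i; rewrite ltnS leq_eqVlt -Di0; case: eqP => //= /val_inj Di.
  by rewrite Di fi0 in fi.
split; last by case fi0: (f i0) => [j|] //; case/arcs: fi0; rewrite Di0 ltnn.
by apply/fitsP; split=> // i j /arcs[/ltnW].
Qed.

(** Source [s] with an arc to [j0]: deleting the arc gives a bijection with the
    choices for the smaller sources in which [j0] no longer awaits a source. *)
Lemma fits_set_row s A f (i0 j0 : 'I_n) :
  i0 = s :> nat -> j0 \in A -> (forall j, j \in A -> s < j)%N ->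
  fits s.+1 s.+1 A (set_row i0 (Some j0) f) && (f i0 == None)
    = fits s s.+1 (A :\ j0) f.
Proof.
move=> Di0 j0A Agt.
have row_i0: set_row i0 (Some j0) f i0 = Some j0 by rewrite ffunE eqxx.
apply/andP/fitsP => [[/fitsP[arcs inj im] /eqP fi0]|[arcs inj im]].
  have rowE i j : f i = Some j -> set_row i0 (Some j0) f i = Some j.
    by move=> fi; rewrite ffunE; case: eqP fi => // ->; rewrite fi0.
  split=> [i j fi|i k j fi fk|j].
  - have [lt_i lt_ij jA] := arcs i j (rowE i j fi).
    have i_i0: i != i0 by apply/eqP => Di; rewrite Di fi0 in fi.
    split=> //; first by move: lt_i; rewrite ltnS leq_eqVlt -Di0 val_eqE (negPf i_i0).
    rewrite !inE; case: eqP jA => //= Dj.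
    by rewrite Dj in fi; rewrite (inj i i0 j0 (rowE _ _ fi) row_i0) eqxx in i_i0.
  - exact: inj (rowE _ _ fi) (rowE _ _ fk).
  - case/setD1P=> j_j0 /im[i]; rewrite ffunE; case: eqP => [_ [Dj]|_ fi].
      by rewrite Dj eqxx in j_j0.
    by exists i.
have fi0: f i0 = None by case fi0: (f i0) => [j|] //; case/arcs: fi0; rewrite Di0 ltnn.
have j0f i : f i <> Some j0.
  by case/arcs=> _ _; rewrite setD11 orbF ltnNge Agt.
split; last by rewrite fi0.
apply/fitsP; split=> [i j|i k j|j jA].
- rewrite ffunE; case: eqP => [-> [<-]|_ /arcs[lt_i lt_ij jA]].
    by rewrite Di0 j0A orbT Agt.
  split=> //; first exact: ltnW.
  by move: jA; rewrite inE; case: (j < _)%N => //= /andP[].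
- rewrite !ffunE; case: eqP => [->|_]; case: eqP => [->|_] //.
  + by move=> [<-] /j0f.
  + by move=> fi [Dj]; rewrite -Dj in fi; case: (j0f i).
  + exact: inj.
have [->|j_j0] := eqVneq j j0; first by exists i0.
have [|i fi] := im j; first by rewrite !inE j_j0.
by exists i; rewrite ffunE; case: eqP fi => // ->; rewrite fi0.
Qed.

(** Being a record depends on smaller sources only, so treating a source
    settles its weight independently of the arcs chosen before it. *)
Lemma row_weight_local f f' (i : 'I_n) :
  (forall k : 'I_n, k <= i -> f k = f' k)%N -> row_weight f i = row_weight f' i.
Proof.
move=> eq_f; have eq_pos (k : 'I_n) : (k <= i)%N -> succ_pos f k = succ_pos f' k.
  by rewrite /succ_pos => /eq_f->.
rewrite /row_weight eq_f //; case: (f' i) => // j.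
rewrite /is_record eq_pos //; congr (if _ && _ then _ else _).
apply: eq_forallb => k; case: ltnP => //= lt_ki.
by rewrite eq_pos // ltnW.
Qed.

Definition is_last A (j0 : 'I_n) := [forall j in A, (j <= j0)%N].

(** The arc [(i0, j0)] is a record iff [j0] is the last awaiting target: the
    remaining elements of [A] all become targets of smaller sources, and every
    other target of a smaller source is at most [s], hence below [j0]. *)
Lemma row_weight_set s A f (i0 j0 : 'I_n) :
  i0 = s :> nat -> j0 \in A -> (forall j, j \in A -> s < j)%N ->
  fits s s.+1 (A :\ j0) f ->
  row_weight (set_row i0 (Some j0) f) i0 = if is_last A j0 then y else v.
Proof.
move=> Di0 j0A Agt /fitsP[arcs inj im]; rewrite /row_weight ffunE eqxx.
have row_i0: succ_pos (set_row i0 (Some j0) f) i0 = j0.+1.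
  by rewrite /succ_pos ffunE eqxx.
have rowE (k : 'I_n) : (k < i0)%N -> succ_pos (set_row i0 (Some j0) f) k = succ_pos f k.
  by move=> lt_k; rewrite /succ_pos ffunE; case: eqP lt_k => // ->; rewrite ltnn.
rewrite /is_record row_i0 /=; congr (if _ then _ else _).
apply/forallP/forall_inP => [rec j jA|last k].
  have [->//|j_j0] := eqVneq j j0.
  have [|i fi] := im j; first by rewrite !inE j_j0.
  have [lt_is _ _] := arcs i j fi; rewrite -Di0 in lt_is.
  by have := rec i; rewrite lt_is /= rowE // /succ_pos fi ltnS => /ltnW.
apply/implyP => lt_k; rewrite rowE // /succ_pos ltnS.
case fk: (f k) => [j|] //; have [_ _] := arcs k j fk.
case/orP=> [lt_j|/setD1P[j_j0 jA]].
  by rewrite (leq_trans lt_j) // Agt.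
by rewrite ltn_neqAle val_eqE j_j0 last.
Qed.

(** The even half step: choose the arc that leaves [s]. *)
Lemma rows_sum_row s A (i0 : 'I_n) :
  i0 = s :> nat -> (forall j, j \in A -> s < j)%N ->
  rows_sum s.+1 s.+1 A = x * rows_sum s s.+1 A +
    \sum_(j in A) (if is_last A j then y else v) * rows_sum s s.+1 (A :\ j).
Proof.
move=> Di0 Agt; rewrite {1}/rows_sum.
have prodS f : \prod_(i < n | (i < s.+1)%N) row_weight f i =
    row_weight f i0 * \prod_(i < n | (i < s)%N) row_weight f i.
  rewrite (bigD1 i0) /=; last by rewrite Di0.
  congr (_ * _); apply: eq_bigl => i.
  by rewrite -val_eqE /= Di0 ltnS [RHS]ltn_neqAle andbC.
pose Q (o : option 'I_n) := if o is Some j then j \in A else true.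
rewrite (partition_big (fun f => f i0) Q) /=; last first.
  move=> f /fitsP[arcs _ _]; case fi0: (f i0) => [j|] //=.
  by case/arcs: fi0 => _; rewrite Di0 => lt_sj; rewrite ltnNge lt_sj.
rewrite (bigD1 None) //=; congr (_ + _).
  rewrite /rows_sum mulr_sumr; apply: eq_big => [f|f /andP[_ /eqP fi0]].
    exact: fits_none.
  by rewrite prodS /row_weight fi0.
rewrite (reindex_omap Some id) /=; last by case.
apply: eq_big => [j|j jA]; first by rewrite andbT eqxx andbT.
rewrite eqxx !andbT in jA.
rewrite (reindex_onto (set_row i0 (Some j)) (set_row i0 None)) /=; last first.
  move=> f /andP[_ /eqP fi0]; apply/ffunP => i; rewrite !ffunE.
  by case: eqP => // ->.
(* [set_row i0 None] deletes the arc of [i0] and [set_row i0 (Some j)] puts it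
   back; this is the condition on [f] left by reindexing along the latter. *)
have condE f : fits s.+1 s.+1 A (set_row i0 (Some j) f)
      && (set_row i0 (Some j) f i0 == Some j)
    && (set_row i0 None (set_row i0 (Some j) f) == f) = fits s s.+1 (A :\ j) f.
  rewrite -(fits_set_row _ Di0 jA Agt) -andbA; congr (_ && _).
  rewrite ffunE !eqxx /=; apply/eqP/eqP => [<-|fi0]; first by rewrite !ffunE eqxx.
  by apply/ffunP => i; rewrite !ffunE; case: eqP => // ->.
rewrite (eq_bigl _ _ condE) /rows_sum mulr_sumr; apply: eq_bigr => f fit.
rewrite prodS (row_weight_set Di0 jA Agt fit); congr (_ * _).
apply: eq_bigr => i lt_is; apply: row_weight_local => k le_ki.
rewrite ffunE; case: eqP => // Dk.
by move: (leq_ltn_trans le_ki lt_is); rewrite Dk Di0 ltnn.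
Qed.

Lemma sum_is_last A : A != set0 ->
  \sum_(j in A) (if is_last A j then y else v) = y + (#|A|.-1)%:R * v.
Proof.
case/set0Pn=> j1 j1A; have [m mA mmax] := arg_maxnP (fun j : 'I_n => j : nat) j1A.
have {}mA : m \in A by [].
have last_m : is_last A m by apply/forall_inP.
rewrite (bigD1 m) //= last_m; congr (_ + _).
rewrite (eq_bigr (fun=> v)) => [|j /andP[jA j_m]].
  rewrite sumr_const mulr_natl; congr (_ *+ _).
  rewrite (cardD1 m A) mA /=; apply: eq_card => j.
  by rewrite !inE andbC.
case: ifP => // /forall_inP/(_ _ mA) le_mj.
by case/eqP: j_m; apply/val_inj/eqP; rewrite eqn_leq le_mj andbT; apply: mmax.
Qed.

Variable alpha : nat -> R.
Hypothesis alpha_odd : forall a, alpha a.*2.+1 = x.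
Hypothesis alpha_even : forall a, alpha a.+1.*2 = y + a%:R * v.

(** The factor [x ^+ #|A|] turns the symmetric recursion of [rows_sum], in which
    the weight [x] is carried by sources without an arc, into that of the Dyck
    paths, in which it is carried by every rise from an even level: each
    awaiting target accounts for one such rise not yet matched by a fall. *)
Lemma rows_sum_dyck s : (s <= n)%N ->
  forall A, (forall j, j \in A -> s <= j)%N ->
  x ^+ #|A| * rows_sum s s A = dyck alpha s.*2 #|A|.*2.
Proof.
elim: s => [_ A _|s IH lt_sn A Age].
  rewrite rows_sum0 /= double_eq0; case: eqP => [->|_]; last exact: mulr0.
  exact: mulr1.
pose i0 := Ordinal lt_sn.
have column A' : (forall j, j \in A' -> s < j)%N ->
    x ^+ #|A'|.+1 * rows_sum s s.+1 A' = dyck alpha s.*2.+1 #|A'|.*2.+1.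
  move=> A'gt; have i0A' : i0 \notin A' by apply/negP => /A'gt; rewrite /= ltnn.
  rewrite (@rows_sum_column s A' i0) // mulrDr exprS -mulrA IH ?(ltnW lt_sn) //; last first.
    by move=> j /A'gt/ltnW.
  have := IH (ltnW lt_sn) (i0 |: A'); rewrite cardsU1 i0A' /= -exprS => -> //.
    by rewrite alpha_odd addrC.
  by move=> j /setU1P[->|/A'gt/ltnW].
rewrite (@rows_sum_row s A i0) // mulrDr mulrA -exprSr column //.
have dyckS l : dyck alpha s.+1.*2 l = dyck alpha s.*2.+1 l.+1 +
    (if l is l'.+1 then alpha l * dyck alpha s.*2.+1 l' else 0) by [].
rewrite dyckS; congr (_ + _).
have [->|A0] := eqVneq A set0.
  by rewrite cards0 big_set0 mulr0.
have [a Da] : exists a, #|A| = a.+1.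
  by exists #|A|.-1; rewrite prednK // card_gt0.
rewrite mulr_sumr Da [RHS]/= -doubleS alpha_even.
transitivity (\sum_(j in A) (if is_last A j then y else v) * dyck alpha s.*2.+1 a.*2.+1).
  apply: eq_bigr => j jA; rewrite mulrCA; congr (_ * _).
  have card_a : #|A :\ j| = a by move: Da; rewrite (cardsD1 j) jA => -[].
  by rewrite -card_a column // => k /setD1P[_ /Age].
by rewrite -mulr_suml sum_is_last // Da.
Qed.

Lemma rows_sum_dyck0 : rows_sum n n set0 = dyck alpha n.*2 0.
Proof.
have := @rows_sum_dyck n (leqnn n) set0; rewrite cards0 mul1r => -> // j.
by rewrite inE.
Qed.

End RowByRow.

(** * Partitions as sets of arcs *)

Section Partitions.

Variable n : nat.

Implicit Types (P : {set {set 'I_n}}) (f : {ffun 'I_n -> option 'I_n}).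

Definition next_map P : {ffun 'I_n -> option 'I_n} :=
  [ffun i => [pick j in pblock P i | (i < j)%N
     & [forall k in pblock P i, (i < k)%N ==> (j <= k)%N]]].

Lemma next_in_blockE P i : next_in_block P i = succ_pos (next_map P) i.
Proof. by rewrite /succ_pos ffunE. Qed.

Lemma is_recordE P i : exclusive_record P i = is_record (next_map P) i.
Proof.
rewrite /exclusive_record /is_record next_in_blockE; congr (_ && _).
by apply: eq_forallb => j; rewrite next_in_blockE.
Qed.

Definition climb f (i : 'I_n) : 'I_n := odflt i (f i).

(** The end of the chain of arcs that starts at [i]; [n] steps always suffice
    to reach it, and the extra ones stay there. *)
Definition block_max f (i : 'I_n) : 'I_n := iter n (climb f) i.

Definition chain_partition f : {set {set 'I_n}} :=
  preim_partition (block_max f) setT.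

Lemma chain_partitionP f : partition (chain_partition f) [set: 'I_n].
Proof. exact: preim_partitionP. Qed.

Lemma mem_pblock_chain f i k :
  (k \in pblock (chain_partition f) i) = (block_max f i == block_max f k).
Proof.
rewrite pblock_equivalence_partition ?inE //.
by move=> a b c _ _ _; split=> // /eqP->.
Qed.

Section Chains.

Variable f : {ffun 'I_n -> option 'I_n}.
Hypothesis f_incr : forall i j : 'I_n, f i = Some j -> (i < j)%N.

Lemma leq_iter_climb m (i : 'I_n) : (i <= iter m (climb f) i)%N.
Proof.
elim: m => //= m IH; apply: leq_trans IH _; rewrite {2}/climb.
by case fi: (f _) => [j|] //=; apply/ltnW/f_incr.
Qed.

Lemma block_max_none i : f (block_max f i) = None.
Proof.
have iter_ge m : f (iter m (climb f) i) = None \/ (m <= iter m (climb f) i)%N.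
  elim: m => [|m [fm|le_m]]; first by right.
    by left; rewrite /= /climb fm /= fm.
  rewrite /=; set c := iter m _ i in le_m *.
  case fc: (f c) => [j|]; last by left; rewrite /climb fc.
  by right; rewrite /climb fc; apply: leq_ltn_trans le_m (f_incr fc).
by case: (iter_ge n) => //; rewrite leqNgt ltn_ord.
Qed.

Lemma block_max_id i : f i = None -> block_max f i = i.
Proof.
by move=> fi; rewrite /block_max iter_fix // /climb fi.
Qed.

Lemma block_max_climb i : block_max f (climb f i) = block_max f i.
Proof.
by rewrite /block_max -iterSr iterS {1}/climb -/(block_max f i) block_max_none.
Qed.

Hypothesis f_inj : forall i k j, f i = Some j -> f k = Some j -> i = k.

(** Injectivity forbids two chains to merge, so elements with the same end lie
    on one chain.  The two claims are proved together, by induction on [b] from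
    the right: if the successor [i] of [b] were beyond [a], the second claim for
    [a] and [i] would give [i] a predecessor that is at least [a], hence
    different from [b]. *)
Lemma same_chain_next (b a : 'I_n) : (b < a)%N -> block_max f a = block_max f b ->
  (exists2 i, f b = Some i & (i <= a)%N) /\ (exists2 d : 'I_n, (b <= d)%N & f d = Some a).
Proof.
have [m] := ubnP (n - b); elim: m b a => // m IH b a lt_m lt_ba eq_max.
have up (c : 'I_n) : (b < c)%N -> (n - c < m)%N.
  move=> lt_bc; rewrite -ltnS; apply: leq_trans lt_m; rewrite ltnS.
  by rewrite ltn_sub2l.
case fb: (f b) => [i|]; last first.
  have := leq_iter_climb n a; rewrite -/(block_max f a) eq_max block_max_id //.
  by rewrite leqNgt lt_ba.
have lt_bi := f_incr fb.
have eq_i : block_max f i = block_max f b by rewrite -(block_max_climb b) /climb fb.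
case: (ltngtP i a) => [lt_ia|lt_ai|/val_inj Di].
- have [_ [d le_id fd]] := IH i a (up _ lt_bi) lt_ia (etrans eq_max (esym eq_i)).
  split; first by exists i; rewrite // ltnW.
  by exists d => //; apply: leq_trans le_id; apply: ltnW.
- have [_ [d le_ad fd]] := IH a i (up _ lt_ba) lt_ai (etrans eq_i (esym eq_max)).
  by move: le_ad; rewrite (f_inj fd fb) leqNgt lt_ba.
- by subst i; split; [exists a | exists b].
Qed.

Lemma next_map_chain : next_map (chain_partition f) = f.
Proof.
apply/ffunP => i; rewrite ffunE.
have next_f j : f i = Some j ->
    [&& j \in pblock (chain_partition f) i, (i < j)%N &
       [forall k in pblock (chain_partition f) i, (i < k)%N ==> (j <= k)%N]].
  move=> fi; rewrite f_incr // mem_pblock_chain -(block_max_climb i) /climb fi eqxx /=.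
  apply/forall_inP => k; rewrite mem_pblock_chain => /eqP eq_max.
  apply/implyP => lt_ik; have [[i' fi' le_i'k] _] := same_chain_next lt_ik (esym eq_max).
  by move: fi'; rewrite fi => -[->].
case: pickP => [j /and3P[jP lt_ij /forall_inP jmin]|no_next].
  rewrite mem_pblock_chain eq_sym in jP.
  have [[i' fi' le_i'j] _] := same_chain_next lt_ij (eqP jP).
  have [i'P lt_ii' _] := and3P (next_f i' fi').
  rewrite fi'; congr Some; apply/val_inj/eqP.
  by rewrite eqn_leq le_i'j (implyP (jmin _ i'P)).
by case fi: (f i) => [j|] //; have := no_next j; rewrite (next_f _ fi).
Qed.

End Chains.

Section NextMap.

Variable P : {set {set 'I_n}}.
Hypothesis partP : partition P [set: 'I_n].

Lemma pblock_refl i : i \in pblock P i.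
Proof. by rewrite mem_pblock (cover_partition partP) inE. Qed.

Lemma eq_pblockE i k : (pblock P i == pblock P k) = (k \in pblock P i).
Proof.
have [_ trivP _] := and3P partP.
by rewrite eq_pblock // (cover_partition partP) inE.
Qed.

Lemma next_mapP i j : next_map P i = Some j ->
  [/\ pblock P j = pblock P i, (i < j)%N &
      forall k, k \in pblock P i -> (i < k)%N -> (j <= k)%N].
Proof.
rewrite ffunE; case: pickP => // j' /and3P[jP lt_ij jmin] [<-].
split=> //; first by apply/esym/eqP; rewrite eq_pblockE.
by move=> k kP; apply/implyP; apply: (forall_inP jmin).
Qed.

Lemma next_map_none (i k : 'I_n) :
  next_map P i = None -> k \in pblock P i -> (k <= i)%N.
Proof.
move=> next_i kP; rewrite leqNgt; apply/negP => lt_ik.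
pose B := [pred k in pblock P i | (i < k)%N].
have Bk : B k by rewrite /= kP.
have [j /andP[jP lt_ij] jmin] := arg_minnP (fun k : 'I_n => k : nat) Bk.
move: next_i; rewrite ffunE; case: pickP => // /(_ j) /negP[].
apply/and3P; split=> //; apply/forall_inP => k' k'P; apply/implyP => lt_ik'.
by apply: jmin; rewrite /= k'P.
Qed.

Lemma next_map_incr i j : next_map P i = Some j -> (i < j)%N.
Proof. by case/next_mapP. Qed.

Lemma next_map_inj i k j :
  next_map P i = Some j -> next_map P k = Some j -> i = k.
Proof.
wlog le_ik : i k / (i <= k)%N.
  by move=> W fi fk; case: (leqP i k) => [le_ik|/ltnW le_ki]; [|apply/esym]; apply: W.
move=> /next_mapP[Pji _ jmin] /next_mapP[Pjk lt_kj _].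
apply/val_inj/eqP; rewrite eqn_leq le_ik leqNgt; apply/negP => lt_ik.
have := jmin k; rewrite -Pji Pjk pblock_refl => /(_ isT lt_ik).
by rewrite leqNgt lt_kj.
Qed.

Lemma pblock_block_max i : pblock P (block_max (next_map P) i) = pblock P i.
Proof.
suff iterP m : pblock P (iter m (climb (next_map P)) i) = pblock P i by apply: iterP.
elim: m => //= m <-; rewrite {1}/climb.
by case fi: (next_map P _) => [j|] //=; case/next_mapP: fi.
Qed.

Lemma max_in_block i k : next_map P i = None -> next_map P k = None ->
  pblock P i = pblock P k -> i = k.
Proof.
move=> fi fk eqP_ik; apply/val_inj/eqP; rewrite eqn_leq.
by rewrite (next_map_none fk) -?eqP_ik ?(next_map_none fi) ?pblock_refl // eqP_ik pblock_refl.
Qed.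

(** A block is recovered from its arcs because its elements all climb to its
    largest element. *)
Lemma chain_next_map : chain_partition (next_map P) = P.
Proof.
rewrite -[RHS](equivalence_partition_pblock partP).
apply: eq_imset => i; apply/setP => k; rewrite !inE -eq_pblockE.
apply/eqP/eqP => [eq_max|eq_block].
  by rewrite -[LHS]pblock_block_max eq_max pblock_block_max.
apply: max_in_block; try exact: block_max_none next_map_incr _.
by rewrite !pblock_block_max.
Qed.

(** Each block contains exactly one element without a successor. *)
Lemma card_blocks : #|P| = #|[set i | next_map P i == None]|.
Proof.
rewrite -(card_in_imset (f := pblock P)); last first.
  by move=> i k; rewrite !inE => /eqP fi /eqP fk; apply: max_in_block.
apply: eq_card => B; apply/idP/imsetP => [BP|[i _ ->]]; last first.
  by rewrite pblock_mem // (cover_partition partP) inE.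
have [_ trivP P0] := and3P partP.
have [b bB] : exists b, b \in B by apply/set0Pn/eqP => B0; rewrite -B0 BP in P0.
exists (block_max (next_map P) b).
  by rewrite inE block_max_none //; apply: next_map_incr.
by rewrite pblock_block_max (def_pblock trivP BP bB).
Qed.

End NextMap.

Lemma fits_next_map P : partition P [set: 'I_n] -> fits n n set0 (next_map P).
Proof.
move=> partP; apply/fitsP; split=> [i j fi|i k j|j]; last by rewrite inE.
  by rewrite ltn_ord (next_map_incr partP fi) ltn_ord.
exact: next_map_inj.
Qed.

Lemma fits_chain f : fits n n set0 f -> next_map (chain_partition f) = f.
Proof.
by case/fitsP=> arcs inj _; apply: next_map_chain inj => i j /arcs[].
Qed.

Lemma partition_weight (R : comNzRingType) (x y v : R) P :
  partition P [set: 'I_n] ->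
  x ^+ #|P| * y ^+ erec P * v ^+ (n - #|P| - erec P) =
  \prod_(i < n) row_weight x y v (next_map P) i.
Proof.
move=> partP; set f := next_map P.
pose maxima := [set i | f i == None].
pose recs := [set i | is_record f i].
have erecE : erec P = #|recs|.
  by apply: eq_card => i; rewrite !inE is_recordE.
have recs_some i : is_record f i -> f i != None.
  by rewrite /is_record /succ_pos; case: (f i).
rewrite [RHS](bigID (mem maxima)) (bigID (mem recs) (fun i => i \notin maxima)) /=.
rewrite (card_blocks partP) -/f -/maxima erecE -mulrA; congr (_ * _).
  rewrite -prodr_const; apply: eq_bigr => i; rewrite inE => /eqP fi.
  by rewrite /row_weight fi.
have recsE i : (i \notin maxima) && (i \in recs) = (i \in recs).
  by rewrite !inE andb_idl //; apply: recs_some.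
rewrite (eq_bigl _ _ recsE); congr (_ * _).
  rewrite -prodr_const; apply: eq_bigr => i; rewrite inE => rec_i.
  by rewrite /row_weight rec_i; case: (f i) (recs_some _ rec_i).
have -> : (n - #|maxima| - #|recs|)%N = #|~: maxima :\: recs|.
  rewrite cardsD [#|~: maxima|]cardsCs setCK card_ord; congr (_ - _)%N.
  by apply: eq_card => i; rewrite in_setI in_setC recsE.
rewrite -prodr_const; apply: eq_big => [i|i].
  by rewrite in_setD in_setC andbC.
rewrite !inE => /andP[/negPf rec_i fi].
by rewrite /row_weight rec_i; case: (f i) fi.
Qed.

Lemma partition_sum (R : comNzRingType) (x y v : R) :
  \sum_(P : {set {set 'I_n}} | partition P [set: 'I_n])
     x ^+ #|P| * y ^+ erec P * v ^+ (n - #|P| - erec P) =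
  rows_sum x y v n n (set0 : {set 'I_n}).
Proof.
rewrite (eq_bigr _ (partition_weight x y v)).
rewrite (reindex_onto chain_partition next_map) => [|P]; last exact: chain_next_map.
apply: eq_big => [f|f /andP[_ /eqP ->]].
  rewrite chain_partitionP /=; apply/eqP/idP => [<-|]; last exact: fits_chain.
  exact/fits_next_map/chain_partitionP.
by apply: eq_bigl => i; rewrite ltn_ord.
Qed.

End Partitions.

Theorem theorem3p1 (x y v : {mpoly int[3]})
  (hx : x = 'X_(@Ordinal 3 0 isT))
  (hy : y = 'X_(@Ordinal 3 1 isT))
  (hv : v = 'X_(@Ordinal 3 2 isT))
  (alpha : nat -> {mpoly int[3]})
  (halpha_odd : forall k : nat, (1 <= k)%N -> alpha (2 * k - 1)%N = x)
  (halpha_even : forall k : nat, (1 <= k)%N ->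
     alpha (2 * k)%N = y + (k - 1)%N%:R * v)
  (B : nat -> {mpoly int[3]})
  (hB : is_Sfraction alpha B)
  (n : nat) :
  B n = \sum_(P : {set {set 'I_n}} | partition P [set: 'I_n])
          x ^+ #|P| * y ^+ erec P * v ^+ (n - #|P| - erec P).
Proof.
rewrite (Sfraction_dyck n hB) partition_sum; apply/esym/rows_sum_dyck0 => a.
  by have := halpha_odd a.+1 isT; rewrite mul2n doubleS subn1.
by have := halpha_even a.+1 isT; rewrite mul2n subn1.
Qed.
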